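(* Consider the following algorithm, given a positive integer $x$: (i) By a sieve, build an array storing for each $n \le x$ a prime factor of $n$ (its largest prime factor found by sieving with all primes up to $\sqrt{x}$ in increasing order, writing $p$ at every multiple of $p$), from which factorizations of integers $\le x$ can be recovered by repeated division and lookup. (ii) Initialize a second array $V$ indexed by $n \le x$ with $V[n] = 2$ for odd $n$ and $V[n]=0$ for even $n$. (iii) For each prime $p \le x$: obtain the factorization of $p-1$, and for each odd prime $r \mid p-1$ set $V[n] = 0$ for every $n \le x$ with $n \equiv p \pmod{pr}$. (iv) For each prime $p \le x$ with $p \equiv 3 \pmod 4$, and each multiple $n \le x$ of $p$ with $V[n] = 2$, set $V[n] = 1$. (v) Output the number of $n \le x$ with $V[n] = 1$. Then this algorithm stores at most $O(x)$ integers of size at most $x$ and runs using $O(x (\log x)(\log\log x))$ bit operations.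
   Context: Complexity is measured in bit operations: adding two $k$-bit integers costs $O(k)$ bit operations. $\log$ is the natural logarithm. *)

(* Defs.v *)
From Stdlib Require Import Arith Reals.

(* bits n = number of binary digits of n (bits 0 = 1).                      *)
(*   multiplication / division / remainder of a,b : bits a * bits b         *)
(*     (schoolbook)                                                         *)
(* Control flow (branching on an already computed boolean) is free; every  *)
(* loop test is an explicitly charged comparison.                           *)
(* The state also records the largest index and largest value ever written  *)
(* to the two arrays (for the space claim), and an [aborted] flag that is   *)
(* set if a loop runs out of its (meta-level) fuel, so that fuel can never  *)
(* silently truncate the computation.                                       *)

Definition bits (n : nat) : nat := Nat.log2 n + 1.

Record St := mkSt {
  arrA : nat -> nat;    (* sieve array: a prime factor of n *)
  arrV : nat -> nat;
  cost : nat;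
  maxidx : nat;
  maxval : nat;
  aborted : bool
}.

Definition M (T : Type) := St -> T * St.

Definition ret {T} (t : T) : M T := fun s => (t, s).
Definition bind {T U} (m : M T) (k : T -> M U) : M U :=
  fun s => let (t, s') := m s in k t s'.

Notation "x <- m ;; k" := (bind m (fun x => k)) (at level 61, m at next level, right associativity).
Notation "m ;;; k" := (bind m (fun _ => k)) (at level 61, right associativity).

Definition charge (c : nat) : M unit :=
  fun s => (tt, mkSt (arrA s) (arrV s) (cost s + c) (maxidx s) (maxval s) (aborted s)).

Definition abort : M unit :=
  fun s => (tt, mkSt (arrA s) (arrV s) (cost s) (maxidx s) (maxval s) true).

Definition addM (a b : nat) : M nat := charge (bits a + bits b) ;;; ret (a + b).
Definition subM (a b : nat) : M nat := charge (bits a + bits b) ;;; ret (a - b).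
Definition mulM (a b : nat) : M nat := charge (bits a * bits b) ;;; ret (a * b).
Definition divM (a b : nat) : M nat := charge (bits a * bits b) ;;; ret (a / b).
Definition modM (a b : nat) : M nat := charge (bits a * bits b) ;;; ret (a mod b).
Definition eqM  (a b : nat) : M bool := charge (bits a + bits b) ;;; ret (Nat.eqb a b).
Definition leM  (a b : nat) : M bool := charge (bits a + bits b) ;;; ret (Nat.leb a b).

Definition upd (f : nat -> nat) (i v : nat) : nat -> nat :=
  fun j => if Nat.eqb j i then v else f j.

Definition readA (i : nat) : M nat :=
  fun s => (arrA s i,
            mkSt (arrA s) (arrV s) (cost s + (bits i + bits (arrA s i)))
                 (maxidx s) (maxval s) (aborted s)).
Definition readV (i : nat) : M nat :=
  fun s => (arrV s i,
            mkSt (arrA s) (arrV s) (cost s + (bits i + bits (arrV s i)))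
                 (maxidx s) (maxval s) (aborted s)).
Definition writeA (i v : nat) : M unit :=
  fun s => (tt, mkSt (upd (arrA s) i v) (arrV s) (cost s + (bits i + bits v))
                     (Nat.max (maxidx s) i) (Nat.max (maxval s) v) (aborted s)).
Definition writeV (i v : nat) : M unit :=
  fun s => (tt, mkSt (arrA s) (upd (arrV s) i v) (cost s + (bits i + bits v))
                     (Nat.max (maxidx s) i) (Nat.max (maxval s) v) (aborted s)).

Fixpoint loopAcc {S} (fuel n step x : nat) (body : nat -> S -> M S) (acc : S) : M S :=
  match fuel with
  | O => abort ;;; ret acc
  | S f => c <- leM n x ;;
           if c then (acc' <- body n acc ;; n' <- addM n step ;;
                      loopAcc f n' step x body acc')
           else ret acc
  end.

Definition loop (fuel n step x : nat) (body : nat -> M unit) : M unit :=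
  loopAcc fuel n step x (fun n _ => body n) tt.

Fixpoint whileM {S} (fuel : nat) (cond : S -> M bool) (body : S -> M S) (st : S) : M S :=
  match fuel with
  | O => abort ;;; ret st
  | S f => c <- cond st ;;
           if c then (st' <- body st ;; whileM f cond body st') else ret st
  end.

(* The algorithm.  Fuel x+2 suffices for every loop (never exhausted).       *)

(* (i) sieve: A[n] := n initially; for p = 2,3,... with p*p <= x, if A[p] = p
   (p prime) write p at every multiple of p.  Afterwards A[n] is the largest
   prime <= sqrt x dividing n, or n itself if there is none. *)
Definition step_i (x : nat) : M unit :=
  loop (x + 2) 1 1 x (fun n => writeA n n) ;;;
  _ <- whileM (x + 2)
         (fun p => pp <- mulM p p ;; leM pp x)
         (fun p => a <- readA p ;; e <- eqM a p ;;
                   (if e then loop (x + 2) p p x (fun n => writeA n p) else ret tt) ;;;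
                   addM p 1)
         2 ;;
  ret tt.

(* primality of p >= 2 via the sieve array *)
Definition isPrimeM (p : nat) : M bool := a <- readA p ;; eqM a p.

Definition step_ii (x : nat) : M unit :=
  loop (x + 2) 1 1 x (fun n => r <- modM n 2 ;; b <- eqM r 1 ;;
                               writeV n (if b then 2 else 0)).

Definition step_iii (x : nat) : M unit :=
  loop (x + 2) 2 1 x (fun p =>
    pr <- isPrimeM p ;;
    if pr then
      (m0 <- subM p 1 ;;
       _ <- whileM (x + 2)
              (fun m => leM 2 m)
              (fun m => q <- readA m ;;              (* a prime factor of m *)
                        o <- modM q 2 ;; b <- eqM o 1 ;;
                        (if b then (s <- mulM p q ;;
                                    loop (x + 2) p s x (fun n => writeV n 0))
                         else ret tt) ;;;
                        whileM (x + 2) (fun m => t <- modM m q ;; eqM t 0)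
                                       (fun m => divM m q) m)
              m0 ;;
       ret tt)
    else ret tt).

Definition step_iv (x : nat) : M unit :=
  loop (x + 2) 2 1 x (fun p =>
    pr <- isPrimeM p ;;
    if pr then
      (t <- modM p 4 ;; b <- eqM t 3 ;;
       if b then loop (x + 2) p p x (fun n => v <- readV n ;; c <- eqM v 2 ;;
                                             if c then writeV n 1 else ret tt)
       else ret tt)
    else ret tt).

Definition step_v (x : nat) : M nat :=
  loopAcc (x + 2) 1 1 x (fun n c => v <- readV n ;; b <- eqM v 1 ;;
                                     if b then addM c 1 else ret c) 0.

Definition algorithm (x : nat) : M nat :=
  step_i x ;;; step_ii x ;;; step_iii x ;;; step_iv x ;;; step_v x.

Definition init_state : St := mkSt (fun _ => 0) (fun _ => 0) 0 0 0 false.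

Definition final_state (x : nat) : St := snd (algorithm x init_state).

(* Main.v *)
Require Import Defs.
From Stdlib Require Import Arith Reals Lra Lia.
From mathcomp Require all_boot zify.
Open Scope R_scope.

(* With L the number of bits of x, every loop iteration costs O(L).  The sieve
   and step (iv) make sum_p x/p iterations, and factoring p - 1 by schoolbook
   division costs O(L log p), because the prime factors q of p - 1, counted with
   multiplicity, satisfy sum_q log q <= log p.  Hence the cost is O(L W) with
     W = x + sum_{p <= x} (x/p + log p + sum_{r | p - 1} x/(p r)),
   p and r ranging over primes, and it remains to show W = O(x log log x).

   The last sum needs a bound on primes p = 1 mod r that is uniform in r and
   saves a power of r.  Let m be the part of n! prime to r.  As r is invertible
   mod m, m divides (r + 1)(2r + 1)...(nr + 1), and so does m times the product
   of the primes p = 1 mod r with n < p <= rn + 1; since n!/m <= r^n, that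
   product is at most (r(r + 1))^n.  So 2^i < p <= 2^(i+1) holds for
   O(2^i log r / (r i)) such primes.  Summing over i costs a factor log log x,
   and sum_r (log r)/r^2 converges; r = 2 gives the bounds on all primes. *)

(* Confines the ssrnat notations: [<=] in the theorem is the order of [Peano]. *)
Module OperationCount.
Import all_boot zify.
Local Open Scope nat_scope.

(** * Primes congruent to 1 modulo a prime *)

Lemma logn_fact_leq r n : prime r -> logn r n`! <= n.
Proof.
move=> r_pr; rewrite logn_fact //.
(* Legendre's formula, with the last quotient added as slack: since [r >= 2], twice [n %/ r ^ K.+1]
   is at most [n %/ r ^ K], so the induction closes. *)
suff H K : \sum_(1 <= k < K.+1) n %/ r ^ k + n %/ r ^ K <= n.
  by apply: leq_trans (H n); exact: leq_addr.
elim: K => [|K IH]; first by rewrite big_geq // expn0 divn1.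
rewrite big_nat_recr //= -addnA; apply: leq_trans IH.
rewrite leq_add2l addnn -muln2 expnSr divnMA.
have H2 : 2 <= r by exact: prime_gt1.
by apply: leq_trans (leq_divM (n %/ r ^ K) r); rewrite leq_mul2l H2 orbT.
Qed.

(** The product is a falling factorial of [n + u], hence a binomial coefficient times the factorial
    of [n]. *)
Lemma fact_dvd_rising u n : n`! %| \prod_(1 <= k < n.+1) (k + u).
Proof.
have -> : \prod_(1 <= k < n.+1) (k + u) = (n + u) ^_ n.
  elim: n => [|n IH]; first by rewrite big_geq.
  by rewrite big_nat_recr //= IH addSn ffactSS mulnC.
by rewrite -bin_ffact dvdn_mull.
Qed.

(* If r u = 1 mod m, then r k + 1 = r (k + u) mod m. *)
Lemma coprime_fact_dvd_progression r n m :
  coprime m r -> m %| n`! -> m %| \prod_(1 <= k < n.+1) (r * k + 1).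
Proof.
move=> co_mr m_dvd.
have m_gt0 : 0 < m by apply: dvdn_gt0 m_dvd; rewrite fact_gt0.
(* [u] is a Bezout coefficient. The case [r = 0] forces [m = 1], where every congruence holds. *)
have [u ru] : exists u, r * u = 1 %[mod m].
  case: (posnP r) => [r0|r_gt0].
    by exists 0; move: co_mr; rewrite r0 /coprime gcdn0 => /eqP ->; rewrite !modn1.
  case: (egcdnP m r_gt0) => u v e _; exists u.
  by rewrite mulnC e gcdnC (eqP co_mr) -modnDml modnMl.
have E : \prod_(1 <= k < n.+1) (r * k + 1)
         = r ^ n * \prod_(1 <= k < n.+1) (k + u) %[mod m].
  elim: n {m_dvd} => [|n IH]; first by rewrite !big_geq.
  have K : r * n.+1 + 1 = r * (n.+1 + u) %[mod m] by rewrite mulnDr -modnDmr -ru modnDmr.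
  by rewrite !(big_nat_recr n.+1) //= -modnMm IH K modnMm expnSr mulnACA.
rewrite /dvdn E -/(dvdn _ _) dvdn_mull //.
exact: dvdn_trans m_dvd (fact_dvd_rising u n).
Qed.

Lemma prod_primes_mul_dvd (s : seq nat) m D :
  uniq s -> all prime s -> all (dvdn ^~ D) s -> all (coprime m) s ->
  m %| D -> (\prod_(p <- s) p) * m %| D.
Proof.
elim: s => [|p s IH] /=; first by rewrite big_nil mul1n.
move=> /andP[p_s us] /andP[p_pr s_pr] /andP[pD sD] /andP[cop cos] mD.
rewrite big_cons -mulnA Gauss_dvd ?pD ?IH // coprimeMr (coprime_sym p m) cop andbT.
rewrite big_seq; apply: (big_ind (coprime p)) => [|a b|q q_s]; first exact: coprimen1.
  by rewrite coprimeMr => -> ->.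
rewrite prime_coprime // dvdn_prime2 ?(allP s_pr q) //.
by apply: contraNneq p_s => ->.
Qed.

Lemma expn_size_leq_prod b (s : seq nat) :
  all (leq b) s -> b ^ size s <= \prod_(p <- s) p.
Proof.
elim: s => [|p s IH] /=; first by rewrite big_nil.
by case/andP=> bp bs; rewrite big_cons expnS leq_mul ?IH.
Qed.

Lemma prod_progression_primes_leq r n (s : seq nat) :
  prime r -> uniq s ->
  all (fun p => [&& prime p, r %| p.-1 & n < p <= r * n + 1]) s ->
  \prod_(p <- s) p <= (r.+1 * r) ^ n.
Proof.
move=> r_pr us /allP hs; have r_gt0 := prime_gt0 r_pr.
pose m := (n`!)`_r^'; pose D := \prod_(1 <= k < n.+1) (r * k + 1).
have m_gt0 : 0 < m by exact: part_gt0.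
have fE : n`! = r ^ logn r n`! * m by rewrite -p_part partnC ?fact_gt0.
have mf : m %| n`! by exact: dvdn_part.
have mD : m %| D.
  apply: coprime_fact_dvd_progression mf.
  by rewrite coprime_sym (@pnat_coprime r) ?pnat_id ?part_pnat.
have key : (\prod_(p <- s) p) * m %| D.
  apply: prod_primes_mul_dvd => //; apply/allP => p /hs /and3P[p_pr r_p /andP[np p_le]] //.
    (* [p] is the factor of [D] with index [(p - 1) / r], which is at most [n] because
       [p <= r * n + 1]. *)
    have -> : p = r * (p.-1 %/ r) + 1.
      by rewrite mulnC divnK // addn1 prednK ?prime_gt0.
    have k_in : p.-1 %/ r \in index_iota 1 n.+1.
      have p_gt1 := prime_gt1 p_pr.
      rewrite mem_index_iota divn_gt0 // dvdn_leq //= ?ltnS; last by lia.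
      by rewrite -(leq_pmul2r r_gt0) divnK //; lia.
    by rewrite /D (big_rem _ k_in) /= dvdn_mulr.
  (* A prime above [n] does not divide the factorial of [n], so it is prime to the divisor [m]. *)
  apply: coprime_dvdl mf _; rewrite coprime_sym prime_coprime //.
  rewrite fact_prod big_seq; apply/negP.
  apply: (big_ind (fun z => p %| z -> False)) => [|a b Ha Hb|k].
  - by rewrite dvdn1 => /eqP p1; rewrite p1 in p_pr.
  - by rewrite Euclid_dvdM // => /orP[].
  - by rewrite mem_index_iota => /andP[k_gt0 k_le] /dvdn_leq; lia.
(* Factor by factor, [r * k + 1 <= (r + 1) * k] for [k >= 1]. *)
have D_le : D <= r.+1 ^ n * n`!.
  have -> : r.+1 ^ n * n`! = \prod_(1 <= k < n.+1) (r.+1 * k).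
    by rewrite big_split /= -fact_prod prod_nat_const_nat subSS subn0.
  rewrite /D !big_seq; apply: leq_prod => k.
  by rewrite mem_index_iota; nia.
have D_gt0 : 0 < D by apply: prodn_gt0 => k; rewrite addn1.
rewrite -(leq_pmul2r m_gt0); apply: leq_trans (dvdn_leq D_gt0 key) _.
apply: leq_trans D_le _; rewrite expnMn -mulnA leq_mul2l; apply/orP; right.
rewrite {1}fE leq_mul2r leq_pexp2l ?orbT //; exact: logn_fact_leq.
Qed.

Definition block_count r i :=
  \sum_((2 ^ i).+1 <= p < (2 ^ i.+1).+1 | prime p && (r %| p.-1)) 1.

(** The [N] primes of the block exceed [2 ^ i], so [(2 ^ i) ^ N <= (r.+1 * r) ^ n <= 2 ^ (l * 2 *
    n)], whence [i * N <= 2 * l * n]. Multiplying by [r] and using [n * r <= 2 * 2 ^ i] gives the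
    constant 4. *)
Lemma block_count_leq r i : prime r ->
  i * block_count r i * r <= 4 * 2 ^ i * (trunc_log 2 r).+1.
Proof.
move=> r_pr; have r_gt1 := prime_gt1 r_pr.
pose P p := prime p && (r %| p.-1).
pose s := filter P (index_iota (2 ^ i).+1 (2 ^ i.+1).+1).
have -> : block_count r i = size s by rewrite /block_count -big_filter sum1_size.
set N := size s; pose n := 2 ^ i.+1 %/ r; set l := (trunc_log 2 r).+1.
have n_le : n * r <= 2 * 2 ^ i by rewrite -expnS leq_divM.
have e_gt0 : 0 < 2 ^ i by rewrite expn_gt0.
have lo : (2 ^ i) ^ N <= \prod_(p <- s) p.
  apply: expn_size_leq_prod; apply/allP => p.
  by rewrite mem_filter mem_index_iota => /andP[_ /andP[/ltnW]].
have hi : \prod_(p <- s) p <= (r.+1 * r) ^ n.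
  apply: prod_progression_primes_leq => //.
    by rewrite filter_uniq // iota_uniq.
  apply/allP => p; rewrite mem_filter mem_index_iota => /andP[/andP[pp rp] /andP[lp up]].
  rewrite pp rp /=; apply/andP; split; first by nia.
  have p_gt0 := prime_gt0 pp.
  suff : p.-1 %/ r <= n by rewrite -(leq_pmul2l (ltnW r_gt1)) [r * (p.-1 %/ r)]mulnC divnK //; lia.
  by apply: leq_div2r; lia.
have r_lt : r < 2 ^ l by rewrite trunc_log_ltn.
have lt2 : (r.+1 * r) ^ n <= 2 ^ (l * 2 * n).
  have [->|n_gt0] := posnP n; first by rewrite muln0.
  by rewrite expnM leq_exp2r // expnM leq_mul // ltnW.
have : i * N <= l * 2 * n.
  rewrite -(@leq_exp2l 2) // expnM; exact: leq_trans (leq_trans lo hi) lt2.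
rewrite -(leq_pmul2r (ltnW r_gt1)) => /leq_trans; apply.
by rewrite -mulnA; nia.
Qed.

(** * Sums over dyadic blocks *)

Lemma leq_sum_nat m n (P : pred nat) (E1 E2 : nat -> nat) :
  (forall k, m <= k < n -> P k -> E1 k <= E2 k) ->
  \sum_(m <= k < n | P k) E1 k <= \sum_(m <= k < n | P k) E2 k.
Proof.
move=> le_E; rewrite big_nat_cond [leqRHS]big_nat_cond.
by apply: leq_sum => k /andP[]; exact: le_E.
Qed.

Lemma leq_sum_widen m n1 n2 (P : pred nat) (E : nat -> nat) :
  n1 <= n2 -> \sum_(m <= k < n1 | P k) E k <= \sum_(m <= k < n2 | P k) E k.
Proof.
move=> le_n; rewrite (big_nat_widen _ n1 n2) // [leqRHS]big_mkcond [leqLHS]big_mkcond.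
by apply: leq_sum => k _; case: (P k); case: (k < n1).
Qed.

Lemma sum_dyadic K (P : pred nat) (F : nat -> nat) :
  \sum_(2 <= p < (2 ^ K).+1 | P p) F p =
  \sum_(0 <= i < K) \sum_((2 ^ i).+1 <= p < (2 ^ i.+1).+1 | P p) F p.
Proof.
elim: K => [|K IH]; first by rewrite !big_geq.
rewrite big_nat_recr //= -IH -big_cat_nat //= ?ltnS ?expn_gt0 //.
by rewrite leq_exp2l.
Qed.

(** A harmonic sum: the block starting at [2 ^ j] has [2 ^ j] terms, each at most [y %/ 2 ^ j], and
    so adds at most [y]. *)
Lemma sum_divn_leq y J : \sum_(1 <= i < 2 ^ J) y %/ i <= y * J.
Proof.
elim: J => [|J IH]; first by rewrite big_geq.
rewrite (@big_cat_nat _ _ _ (2 ^ J)) ?expn_gt0 ?leq_exp2l //= mulnS addnC.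
apply: leq_add => //; apply: (@leq_trans (\sum_(2 ^ J <= i < 2 ^ J.+1) y %/ 2 ^ J)).
  by apply: leq_sum_nat => i /andP[le_i _] _; apply: leq_div2l; rewrite ?expn_gt0.
rewrite sum_nat_const_nat expnS mul2n -addnn addnK mulnC; exact: leq_divM.
Qed.

Lemma sum_log_div_sqr_leq y J :
  \sum_(1 <= r < 2 ^ J) (y * (trunc_log 2 r).+1) %/ r ^ 2 <= 4 * y.
Proof.
pose S j := \sum_(1 <= r < 2 ^ j) (y * (trunc_log 2 r).+1) %/ r ^ 2.
(* The block at [2 ^ j] adds at most [y * (j + 1) / 2 ^ j]. The tail of that series from [j = J] on
   is [y * (2 * J + 4) / 2 ^ J], which is [4 * y] at [J = 0]; including it makes the induction
   close. *)
suff H : 2 ^ J * S J + y * (2 * J + 4) <= 4 * y * 2 ^ J.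
  rewrite -(@leq_pmul2r (2 ^ J)) ?expn_gt0 // mulnC.
  exact: leq_trans (leq_addr _ _) H.
elim: J => [|J IH]; first by rewrite /S big_geq //; lia.
have : S J.+1 <= S J + (y * J.+1) %/ 2 ^ J.
  rewrite /S (@big_cat_nat _ _ _ (2 ^ J)) ?expn_gt0 ?leq_exp2l //= leq_add2l.
  apply: (@leq_trans (\sum_(2 ^ J <= r < 2 ^ J.+1) (y * J.+1) %/ (2 ^ J) ^ 2)).
    apply: leq_sum_nat => r /andP[le_r lt_r] _.
    rewrite (@trunc_log_eq 2 J) ?le_r //.
    by apply: leq_div2l; rewrite ?expn_gt0 ?leq_exp2r.
  rewrite sum_nat_const_nat expnS mul2n -addnn addnK expnS expn1 divnMA.
  by rewrite mulnC; exact: leq_divM.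
have := leq_divM (y * J.+1) (2 ^ J); rewrite expnS.
by move: (2 ^ J) ((y * J.+1) %/ _) IH => e t; nia.
Qed.

Lemma block_sum_div_leq r y i : prime r -> 0 < i ->
  \sum_((2 ^ i).+1 <= p < (2 ^ i.+1).+1 | prime p && (r %| p.-1)) y %/ p
  <= ((4 * y * (trunc_log 2 r).+1) %/ r) %/ i.
Proof.
move=> r_pr i_gt0; have r_gt0 := prime_gt0 r_pr.
apply: (@leq_trans (block_count r i * (y %/ 2 ^ i))).
  rewrite /block_count big_distrl /=; apply: leq_sum_nat => p /andP[lt_p _] _.
  by rewrite mul1n; apply: leq_div2l; rewrite ?expn_gt0 // ltnW.
rewrite -divnMA leq_divRL ?muln_gt0 ?r_gt0 //.
have := block_count_leq r i r_pr; have := leq_divM y (2 ^ i).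
by move: (2 ^ i) (trunc_log _ _).+1 (block_count _ _) (y %/ 2 ^ i) => e l N a; nia.
Qed.

(** * Sums over primes *)

Lemma lt_expn_trunc_log2 x : (trunc_log 2 x).+1 <= 2 ^ (trunc_log 2 (trunc_log 2 x)).+1.
Proof. exact: trunc_log_ltn. Qed.

(** Block [i] contributes a quotient by [i], and [i] runs only up to [trunc_log 2 x]; the harmonic
    sum over [i] is what produces the iterated logarithm. *)
Lemma progression_sum_div_leq r y x : prime r ->
  \sum_(2 <= p < x.+1 | prime p && (r %| p.-1)) y %/ p
  <= ((4 * y * (trunc_log 2 r).+1) %/ r) * (trunc_log 2 (trunc_log 2 x)).+1.
Proof.
move=> r_pr; set l := trunc_log 2 x.
have x_lt : x < 2 ^ l.+1 by exact: trunc_log_ltn.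
apply: leq_trans (leq_sum_widen _ _ _ _ _ x_lt) _.
apply: leq_trans (leq_sum_widen _ _ _ _ _ (leqnSn _)) _.
(* Block 0, where division by [i] would fail, holds only [p = 2], and [r] does not divide 1. *)
rewrite sum_dyadic big_ltn // expn0 expn1 big_mkcond big_nat1 /=.
have /negPf r_neq1 : r != 1 by rewrite neq_ltn prime_gt1 ?orbT.
rewrite dvdn1 r_neq1 /= add0n.
apply: leq_trans (sum_divn_leq _ _).
apply: leq_trans (leq_sum_widen _ _ _ _ _ (lt_expn_trunc_log2 x)).
by apply: leq_sum_nat => i /andP[i_gt0 _] _; exact: block_sum_div_leq.
Qed.

Lemma prime_gt2_dvd2_pred p : prime p -> 2 < p -> 2 %| p.-1.
Proof.
move=> p_pr p_gt2; case: (even_prime p_pr) => [p2|p_odd]; first by rewrite p2 in p_gt2.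
by rewrite dvdn2 -oddS prednK ?prime_gt0 // p_odd.
Qed.

(** Every odd prime is 1 modulo 2, so apart from the prime 2 a sum over all primes is the
    progression sum for [r = 2]. *)
Lemma sum_prime_split x (F : nat -> nat) : 1 < x ->
  \sum_(2 <= p < x.+1 | prime p) F p =
  F 2 + \sum_(2 <= p < x.+1 | prime p && (2 %| p.-1)) F p.
Proof.
move=> x_gt1; have x_gt2 : 2 < x.+1 by [].
rewrite !(big_ltn_cond x_gt2) /=; congr (_ + _).
rewrite big_nat_cond [RHS]big_nat_cond; apply: eq_bigl => p.
case: (boolP (2 < p < x.+1)) => //= /andP[p_gt2 _].
by case: (boolP (prime p)) => //= /prime_gt2_dvd2_pred ->.
Qed.

Lemma sum_prime_div_leq x : 1 < x ->
  \sum_(2 <= p < x.+1 | prime p) x %/ p <= 5 * x * (trunc_log 2 (trunc_log 2 x)).+1.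
Proof.
move=> x_gt1; rewrite sum_prime_split //.
have := @progression_sum_div_leq 2 x x isT.
have -> : 4 * x * (trunc_log 2 2).+1 %/ 2 = 4 * x.
  by rewrite (_ : trunc_log 2 2 = 1) // mulnK.
have := leq_div x 2; move: (x %/ 2) (\sum_(_ <= _ < _ | _) _) (trunc_log _ _) => a S l.
nia.
Qed.

(** A Chebyshev bound. For [k >= 1], block [k] holds [N] odd primes with [k * N <= 4 * 2 ^ k], each
    of weight at most [k + 2 <= 3 * k], so it adds at most [12 * 2 ^ k]. The geometric sum is at
    most [12 * 2 ^ l.+1 <= 24 * x], and the prime 2 adds 2. *)
Lemma sum_prime_log_leq x : 1 < x ->
  \sum_(2 <= p < x.+1 | prime p) (trunc_log 2 p).+1 <= 26 * x.
Proof.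
move=> x_gt1; rewrite sum_prime_split //; set l := trunc_log 2 x.
have x_lt : x < 2 ^ l.+1 by exact: trunc_log_ltn.
have l_le : 2 ^ l <= x by apply: trunc_logP => //; lia.
suff : \sum_(2 <= p < (2 ^ l.+1).+1 | prime p && (2 %| p.-1)) (trunc_log 2 p).+1
       <= 12 * 2 ^ l.+1.
  have := leq_sum_widen 2 _ _ (fun p => prime p && (2 %| p.-1))
            (fun p => (trunc_log 2 p).+1) (leq_trans x_lt (leqnSn _)).
  by rewrite expnS (_ : trunc_log 2 2 = 1) //; lia.
rewrite sum_dyadic; elim: l.+1 => [|k IH]; first by rewrite big_geq.
rewrite big_nat_recr //= [in leqRHS]expnS [2 * _]mul2n -addnn mulnDr leq_add //.
apply: (@leq_trans (block_count 2 k * k.+2)).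
  rewrite /block_count big_distrl /=; apply: leq_sum_nat => p /andP[_ p_le] _.
  rewrite mul1n ltnS; apply: leq_trans (leq_trunc_log 2 (n := 2 ^ k.+1) _) _ => //.
  by rewrite trunc_expnK.
case: k {IH} => [|k]; first by rewrite /block_count big_mkcond big_nat1.
have := block_count_leq 2 k.+1 isT; rewrite (_ : trunc_log 2 2 = 1) //.
by move: (2 ^ k.+1) (block_count _ _) => e N; nia.
Qed.

(** Exchanging the sums puts [r] outside. For fixed [r] the progression bound at [y = x %/ r] leaves
    a term of order [x * log r / r ^ 2], whose sum over [r] converges. *)
Lemma sum_prime_pred_divisors_leq x :
  \sum_(2 <= p < x.+1 | prime p)
    \sum_(2 <= r < x.+1 | prime r && (r %| p.-1)) x %/ (p * r)
  <= 16 * x * (trunc_log 2 (trunc_log 2 x)).+1.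
Proof.
rewrite (exchange_big_dep prime) => [|p r _ /andP[]//] /=.
set J := (trunc_log 2 (trunc_log 2 x)).+1.
apply: (@leq_trans (\sum_(2 <= r < x.+1 | prime r)
          (4 * x * (trunc_log 2 r).+1) %/ r ^ 2 * J)).
  apply: leq_sum => r r_pr.
  apply: (@leq_trans (\sum_(2 <= p < x.+1 | prime p && (r %| p.-1)) (x %/ r) %/ p)).
    rewrite big_mkcondr /= [leqRHS]big_mkcondr; apply: leq_sum => p _.
    by rewrite r_pr /= mulnC divnMA.
  apply: leq_trans (progression_sum_div_leq _ _ _ r_pr) _.
  rewrite leq_mul2r; apply/orP; right.
  rewrite expnS expn1 divnMA; apply: leq_div2r.
  rewrite leq_divRL ?prime_gt0 //; have := leq_divM x r; nia.
rewrite -big_distrl /= leq_mul2r; apply/orP; right.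
have -> : 16 * x = 4 * (4 * x) by lia.
apply: leq_trans (sum_log_div_sqr_leq _ (trunc_log 2 x).+1).
apply: leq_trans (leq_sum_widen _ _ _ _ _ (trunc_log_ltn x (isT : 1 < 2))).
have [->|x_gt0] := posnP x; first by rewrite big_geq.
rewrite [leqRHS]big_ltn //; apply: leq_trans (leq_addl _ _).
by rewrite big_mkcond /=; apply: leq_sum => r _; case: ifP.
Qed.

(** * Time credits *)

Lemma Nat_eqbE m n : Nat.eqb m n = (m == n).
Proof. by apply/idP/eqP => /Nat.eqb_eq. Qed.

Lemma Nat_lebE m n : Nat.leb m n = (m <= n).
Proof. by apply/idP/idP => [/Nat.leb_le/leP|/leP/Nat.leb_le]. Qed.

Lemma Nat_divE m n : Nat.div m n = m %/ n.
Proof.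
case: n => [|n]; first by rewrite divn0.
apply/esym/(Nat.div_unique _ _ _ (m %% n.+1)); first by apply/ltP; rewrite ltn_mod.
by rewrite {1}(divn_eq m n.+1) mulnC.
Qed.

Lemma Nat_moduloE m n : Nat.modulo m n = m %% n.
Proof.
case: n => [|n]; first by rewrite modn0.
apply/esym/(Nat.mod_unique _ _ (m %/ n.+1)); first by apply/ltP; rewrite ltn_mod.
by rewrite {1}(divn_eq m n.+1) mulnC.
Qed.

Lemma bitsE n : bits n = (trunc_log 2 n).+1.
Proof.
rewrite /bits Nat.add_1_r; congr _.+1; apply/esym.
have [->//|n_gt0] := posnP n; apply: trunc_log_eq => //.
have powE k : Nat.pow 2 k = 2 ^ k by elim: k => //= k ->; rewrite expnS; lia.
by have [/leP lo /ltP hi] := Nat.log2_spec n (elimT ltP n_gt0); rewrite -!powE lo hi.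
Qed.

Lemma bits_gt0 n : 0 < bits n. Proof. by rewrite bitsE. Qed.

Lemma leq_bits m n : m <= n -> bits m <= bits n.
Proof. by move=> le_mn; rewrite !bitsE ltnS leq_trunc_log. Qed.

Lemma bits_leq n k : n < 2 ^ k -> 0 < k -> bits n <= k.
Proof.
move=> lt_n k_gt0; have [->//|n_gt0] := posnP n.
by rewrite bitsE -(ltn_exp2l (m := 2)) //; apply: leq_ltn_trans lt_n; exact: trunc_logP.
Qed.

Lemma ltn_2bits n : n < 2 ^ bits n.
Proof. by rewrite bitsE trunc_log_ltn. Qed.

Lemma bits_leq_self n : 0 < n -> bits n <= n.
Proof. by move=> n_gt0; apply: bits_leq n_gt0; exact: ltn_expl. Qed.

(** The bound on [arrV] caps the price of reading a mark, so that [wp] can leave the contents of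
    that array unspecified. *)
Definition fine x s :=
  [/\ aborted s = false, maxidx s <= x, maxval s <= x & forall n, arrV s n <= 2].

(* Time credits: started with sieve array [a] and [c] credits, [m] pays for
   every bit operation and stops with unspent credits satisfying [Q]. *)
Definition wp x T (m : M T) (Q : T -> (nat -> nat) -> nat -> Prop) a c :=
  forall s, fine x s -> arrA s = a ->
  fine x (m s).2 /\
  exists2 c', cost (m s).2 + c' <= cost s + c & Q (m s).1 (arrA (m s).2) c'.
Arguments wp x {T}.

Section WeakestPrecondition.
Variables (x : nat) (T : Type).
Implicit Types (Q : T -> (nat -> nat) -> nat -> Prop) (m : M T).

Lemma wp_conseq Q m (Q' : T -> (nat -> nat) -> nat -> Prop) a c :
  wp x m Q a c -> (forall t a' c', Q t a' c' -> Q' t a' c') -> wp x m Q' a c.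
Proof.
move=> wpm QQ' s fs sa; have [fs' [c' le_c Qc]] := wpm s fs sa.
by split=> //; exists c' => //; exact: QQ'.
Qed.

(** Credits set aside before [m] survive it; loops use this to save for later iterations. *)
Lemma wp_frame f Q m a c :
  wp x m Q a c -> wp x m (fun t a' c' => f <= c' /\ Q t a' (c' - f)) a (c + f).
Proof.
move=> wpm s fs sa; have [fs' [c' le_c Qc]] := wpm s fs sa.
split=> //; exists (c' + f); first by lia.
by rewrite leq_addl addnK.
Qed.

Lemma wp_waste c0 Q m a c : wp x m Q a c0 -> c0 <= c -> wp x m Q a c.
Proof.
move=> wpm le_c s fs sa; have [fs' [c' le_c' Qc]] := wpm s fs sa.
by split=> //; exists c' => //; lia.
Qed.

Lemma wp_ret t Q a c : Q t a c -> wp x (ret t) Q a c.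
Proof. by move=> Qt s fs sa; split=> //; exists c; rewrite //= sa. Qed.

Lemma wp_bind U (m : M U) (k : U -> M T) Q a c :
  wp x m (fun u a' c' => wp x (k u) Q a' c') a c -> wp x (bind m k) Q a c.
Proof.
move=> wpm s fs sa; have [] := wpm s fs sa; rewrite /bind.
case: (m s) => u s' /= fs' [c' le_c' wpk].
have [fs'' [c'' le_c'' Qc]] := wpk s' fs' erefl.
by split=> //; exists c'' => //; lia.
Qed.

End WeakestPrecondition.

Section Primitives.
Variable x : nat.

(** [e] is a chosen upper bound for the price [d]. Paying [e] lets later proofs calculate with round
    prices such as [2 * bits x]. *)
Lemma wp_charge d e Q a c :
  d <= e <= c -> Q tt a (c - e) -> wp x (charge d) Q a c.
Proof.
move=> le_dec Qt s fs sa; split; first by case: fs.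
by exists (c - e); rewrite /= ?sa //; lia.
Qed.

Lemma wp_add e u v Q a c :
  bits u + bits v <= e <= c -> Q (u + v) a (c - e) -> wp x (addM u v) Q a c.
Proof.
by move=> le_e Qt; apply: wp_bind; apply: (wp_charge _ e) => //; exact: wp_ret.
Qed.

Lemma wp_sub e u v Q a c :
  bits u + bits v <= e <= c -> Q (u - v) a (c - e) -> wp x (subM u v) Q a c.
Proof.
by move=> le_e Qt; apply: wp_bind; apply: (wp_charge _ e) => //; exact: wp_ret.
Qed.

Lemma wp_mul e u v Q a c :
  bits u * bits v <= e <= c -> Q (u * v) a (c - e) -> wp x (mulM u v) Q a c.
Proof.
by move=> le_e Qt; apply: wp_bind; apply: (wp_charge _ e) => //; exact: wp_ret.
Qed.

Lemma wp_div e u v Q a c :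
  bits u * bits v <= e <= c -> Q (u %/ v) a (c - e) -> wp x (divM u v) Q a c.
Proof.
rewrite -Nat_divE => le_e Qt.
by apply: wp_bind; apply: (wp_charge _ e) => //; exact: wp_ret.
Qed.

Lemma wp_mod e u v Q a c :
  bits u * bits v <= e <= c -> Q (u %% v) a (c - e) -> wp x (modM u v) Q a c.
Proof.
rewrite -Nat_moduloE => le_e Qt.
by apply: wp_bind; apply: (wp_charge _ e) => //; exact: wp_ret.
Qed.

Lemma wp_eq e u v Q a c :
  bits u + bits v <= e <= c -> Q (u == v) a (c - e) -> wp x (eqM u v) Q a c.
Proof.
rewrite -Nat_eqbE => le_e Qt.
by apply: wp_bind; apply: (wp_charge _ e) => //; exact: wp_ret.
Qed.

Lemma wp_le e u v Q a c :
  bits u + bits v <= e <= c -> Q (u <= v) a (c - e) -> wp x (leM u v) Q a c.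
Proof.
rewrite -(Nat_lebE u v) => le_e Qt.
by apply: wp_bind; apply: (wp_charge _ e) => //; exact: wp_ret.
Qed.

Lemma wp_readA e n Q a c :
  bits n + bits (a n) <= e <= c -> Q (a n) a (c - e) -> wp x (readA n) Q a c.
Proof.
move=> le_e Qt s fs sa; split; first by case: fs.
by exists (c - e); rewrite /= ?sa //; lia.
Qed.

Lemma wp_readV e n Q a c :
  bits n + 2 <= e <= c -> (forall v, v <= 2 -> Q v a (c - e)) -> wp x (readV n) Q a c.
Proof.
move=> le_e Qt s fs sa; split; first by case: fs.
have [_ _ _ /(_ n) v_le] := fs; exists (c - e); last by rewrite /= sa; exact: Qt.
by have := leq_bits _ _ v_le; rewrite /= (_ : bits 2 = 2) //; lia.
Qed.

Lemma wp_writeA e n v Q a c :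
  n <= x -> v <= x -> bits n + bits v <= e <= c ->
  Q tt (upd a n v) (c - e) -> wp x (writeA n v) Q a c.
Proof.
move=> n_le v_le le_e Qt s [] fa fi fv fV sa; split;
  last by exists (c - e); rewrite /= ?sa //; lia.
by split=> //=; lia.
Qed.

(** The marks go up to 2, so [1 < x] is what keeps [maxval] at most [x]. *)
Lemma wp_writeV e n v Q a c :
  1 < x -> n <= x -> v <= 2 -> bits n + bits v <= e <= c ->
  Q tt a (c - e) -> wp x (writeV n v) Q a c.
Proof.
move=> x_gt1 n_le v_le le_e Qt s [] fa fi fv fV sa; split;
  last by exists (c - e); rewrite /= ?sa //; lia.
split=> //= [||k]; [lia | lia |].
by rewrite /upd; case: ifP.
Qed.

End Primitives.

(** * Rules for loops *)

(** The measure [mu] starts below the fuel and drops in every iteration, so the fuel never runs out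
    and [abort] is never reached. *)
Lemma wp_while x T (I : T -> (nat -> nat) -> nat -> Prop) (mu : T -> nat) Q fuel
    (cond : T -> M bool) (body : T -> M T) t a c :
  (forall t a c, I t a c ->
     wp x (cond t) (fun b a' c' =>
       if b then wp x (body t) (fun t' a'' c'' => I t' a'' c'' /\ mu t' < mu t) a' c'
       else Q t a' c') a c) ->
  I t a c -> mu t < fuel -> wp x (whileM fuel cond body t) Q a c.
Proof.
move=> step; elim: fuel t a c => [//|fuel IH] t a c It mu_lt /=.
apply: wp_bind; apply: wp_conseq (step t a c It) _ => -[|] a' c' //; last exact: wp_ret.
move=> wp_body; apply: wp_bind; apply: wp_conseq wp_body _ => t' a'' c'' [It' mu_lt'].
by apply: IH => //; lia.
Qed.

(** A test and an increment cost at most [2 * B] each. The extra [2 * B] pays for the coming test;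
    the [4 * B] taken from each iteration pays for its increment and for the next test. *)
Lemma wp_loopAcc x T (I : nat -> T -> (nat -> nat) -> nat -> Prop) B Q fuel n step
    (body : nat -> T -> M T) t a c :
  0 < step -> bits (x + step) <= B ->
  (forall n t a c, n <= x -> I n t a c ->
     4 * B <= c /\ wp x (body n t) (I (n + step)) a (c - 4 * B)) ->
  (forall n t a c, x < n -> I n t a c -> Q t a c) ->
  I n t a c -> n <= x + step -> x + 1 - n < fuel ->
  wp x (loopAcc fuel n step x body t) Q a (c + 2 * B).
Proof.
move=> step_gt0 le_B inv done.
have bits_le k : k <= x + step -> bits k <= B by move/leq_bits/leq_trans; apply.
have bits_x := bits_le x (leq_addr _ _); have bits_step := bits_le step (leq_addl _ _).
elim: fuel n t a c => [//|fuel IH] n t a c In n_le n_lt /=.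
have bits_n := bits_le n n_le.
apply: wp_bind; apply: (wp_le _ (2 * B)); first by lia.
case: leqP => [n_lex|n_gtx]; last by apply/wp_ret; rewrite addnK; exact: (done n).
have [c_ge wp_body] := inv n t a c n_lex In.
rewrite addnK -(subnK c_ge).
apply/wp_bind/(wp_conseq _ _ _ _ _ _ _ (wp_frame _ _ (4 * B) _ _ _ _ wp_body)).
move=> t' a' c' [c'_ge In']; apply: wp_bind; apply: (wp_add _ (2 * B)); first by lia.
have -> : c' - 2 * B = (c' - 4 * B) + 2 * B by lia.
by apply: IH => //; lia.
Qed.

(** The largest step of any loop is a product of two primes at most [x]; this bounds the counter
    even after it overshoots [x]. *)
Lemma bits_add_leq x m : m <= x * x -> bits (x + m) <= 2 * bits x.
Proof.
move=> m_le; have x_lt := ltn_2bits x; apply: bits_leq; last by rewrite muln_gt0 bits_gt0.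
by rewrite mulnC expnM expnS expn1; nia.
Qed.

Lemma wp_loop_const x T (J : nat -> T -> (nat -> nat) -> Prop) k c Q fuel n step
    (body : nat -> T -> M T) t a c0 :
  0 < step <= x * x -> n <= x -> x + 1 < fuel -> J n t a ->
  (forall n t a, n <= x -> J n t a ->
     wp x (body n t) (fun t' a' _ => J (n + step) t' a') a k) ->
  (forall m t a c', x < m -> J m t a -> c <= c' -> Q t a c') ->
  c + ((x - n) %/ step).+1 * (8 * bits x + k) + 4 * bits x <= c0 ->
  wp x (loopAcc fuel n step x body t) Q a c0.
Proof.
move=> /andP[step_gt0 /bits_add_leq le_B] n_le fuel_gt Jn inv done le_c0.
(* [W n] is the price of the iterations left at counter [n]. With [B = 2 * bits x], the overhead
   [4 * B] is [8 * bits x] and the final test is [4 * bits x]. *)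
pose W n := if n <= x then ((x - n) %/ step).+1 * (8 * bits x + k) else 0.
have W_step m : m <= x -> W m = 8 * bits x + k + W (m + step).
  move=> m_le; rewrite /W m_le; case: leqP => [le_x|lt_x]; last by rewrite divn_small; lia.
  have -> : x - m = step + (x - (m + step)) by lia.
  by rewrite divnDl // divnn step_gt0 add1n mulSn.
pose I n t a c' := J n t a /\ c + W n <= c'.
apply: (wp_waste _ _ _ _ _ _ _ _ le_c0); rewrite (_ : 4 * bits x = 2 * (2 * bits x)); last by lia.
apply: (wp_loopAcc _ _ I _ _ _ _ _ _ _ _ _ step_gt0 le_B); last 3 first.
- by split; rewrite // /W n_le.
- by apply: leq_trans n_le (leq_addr _ _).
- by lia.
- move=> {t a Jn n_le le_c0} {}n t a c' n_le [Jn]; rewrite W_step // => c'_ge.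
  split; first by lia.
  have := wp_frame _ _ (c + W (n + step)) _ _ _ _ (inv n t a n_le Jn).
  move/wp_waste=> /(_ (c' - 4 * (2 * bits x))) H; apply: wp_conseq (H _) _; first by lia.
  by move=> t' a' c'' [c''_ge Jn'].
- by move=> m t' a' c' m_gt [Jm c'_ge]; apply: (done m) => //; lia.
Qed.

Lemma wp_loop_sum x (J : nat -> (nat -> nat) -> Prop) (k : nat -> nat) c Q fuel n
    (body : nat -> M unit) a c0 :
  0 < x -> n <= x + 1 -> x + 1 < fuel -> J n a ->
  (forall n a, n <= x -> J n a -> wp x (body n) (fun _ a' _ => J (n + 1) a') a (k n)) ->
  (forall m t a c', x < m -> J m a -> c <= c' -> Q t a c') ->
  c + \sum_(n <= m < x.+1) (8 * bits x + k m) + 4 * bits x <= c0 ->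
  wp x (loop fuel n 1 x body) Q a c0.
Proof.
move=> x_gt0 n_le fuel_gt Jn inv done le_c0.
have le_B : bits (x + 1) <= 2 * bits x by apply: bits_add_leq; rewrite muln_gt0 x_gt0.
pose W n := \sum_(n <= m < x.+1) (8 * bits x + k m).
pose I n (t : unit) a c' := J n a /\ c + W n <= c'.
apply: (wp_waste _ _ _ _ _ _ _ _ le_c0); rewrite (_ : 4 * bits x = 2 * (2 * bits x)); last by lia.
apply: (wp_loopAcc _ _ I _ _ _ _ _ _ _ _ _ _ le_B) => //; last by lia.
- move=> {a Jn n_le le_c0} {}n t a c' n_le [Jn].
  rewrite /W big_ltn // -/(W n.+1) => c'_ge; split; first by lia.
  have := wp_frame _ _ (c + W n.+1) _ _ _ _ (inv n a n_le Jn).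
  move/wp_waste=> /(_ (c' - 4 * (2 * bits x))) H; apply: wp_conseq (H _) _; first by lia.
  by rewrite addn1 => t' a' c'' [c''_ge Jn'].
- by move=> m t' a' c' m_gt [Jm c'_ge]; apply: (done m) => //; lia.
Qed.

(** * The five steps *)

(** The sieve invariant when [p] is the next candidate: the two cases are entries not yet
    overwritten and entries already overwritten. *)
Definition sieved x p (a : nat -> nat) := forall n, 0 < n <= x ->
  (a n = n /\ forall q, prime q -> q < p -> ~~ (q %| n)) \/
  [/\ prime (a n), a n %| n & a n < p].

Definition prime_factor_table x (a : nat -> nat) :=
  forall n, 1 < n <= x -> prime (a n) /\ a n %| n.

(** Correctness of the primality test made during the sieve: a composite [p] has a prime factor
    below [p], so its entry has already been overwritten. *)
Lemma sieved_prime x p a : 1 < p <= x -> sieved x p a -> (a p == p) = prime p.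
Proof.
move=> /andP[p_gt1 p_le] /(_ p); rewrite p_le ltnW // => /(_ isT) [[-> no_q]|[ap_pr ap_dvd ap_lt]].
  rewrite eqxx; apply/esym/idPn => p_npr.
  have pd_lt : pdiv p < p.
    rewrite ltn_neqAle pdiv_leq ?andbT; last by lia.
    by apply: contraNneq p_npr => <-; exact: pdiv_prime.
  by move: (no_q _ (pdiv_prime p_gt1) pd_lt); rewrite pdiv_dvd.
rewrite ltn_eqF //; apply/esym/negP => p_pr.
by move: ap_dvd; rewrite dvdn_prime2 // => /eqP ap; rewrite ap ltnn in ap_lt.
Qed.

Lemma sieved_skip x p a : ~~ prime p -> sieved x p a -> sieved x p.+1 a.
Proof.
move=> p_npr Sa n n_in; have [[an no_q]|[an_pr an_dvd an_lt]] := Sa n n_in; [left|right].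
  split=> // q q_pr; rewrite ltnS leq_eqVlt => /predU1P[qp|]; last exact: no_q.
  by rewrite qp (negPf p_npr) in q_pr.
by split=> //; exact: leqW.
Qed.

Lemma sieved_write x p a a' : prime p -> sieved x p a ->
  (forall n, 0 < n <= x -> a' n = if p %| n then p else a n) -> sieved x p.+1 a'.
Proof.
move=> p_pr Sa a'E n n_in; rewrite a'E //; case: ifP => p_n; first by right.
have [[an no_q]|[an_pr an_dvd an_lt]] := Sa n n_in; [left|right].
  split=> // q q_pr; rewrite ltnS leq_eqVlt => /predU1P[->|]; last exact: no_q.
  by rewrite p_n.
by split=> //; exact: leqW.
Qed.

(** An untouched composite [n <= x] would have a prime factor at most its square root, hence below
    [p]. *)
Lemma sieved_done x p a : x < p * p -> sieved x p a -> prime_factor_table x a.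
Proof.
move=> x_lt Sa n /andP[n_gt1 n_le].
have [|[an no_q]|[]//] := Sa n; first by rewrite n_le ltnW.
rewrite an; split=> //; apply/idPn => n_npr.
have pd_sqr : pdiv n ^ 2 <= n.
  by rewrite leqNgt; apply: contra n_npr; apply: ltn_pdiv2_prime; lia.
have pd_lt : pdiv n < p by nia.
by move: (no_q _ (pdiv_prime n_gt1) pd_lt); rewrite pdiv_dvd.
Qed.

Lemma bits_gt1 n : 1 < n -> 1 < bits n.
Proof. by move=> n_gt1; apply: leq_trans (leq_bits 2 n n_gt1). Qed.

Lemma sieved_leq x p a n : sieved x p a -> 0 < n <= x -> a n <= x.
Proof.
move=> Sa n_in; have [[-> _]|[_ /dvdn_leq le_n _]] := Sa n n_in; first by case/andP: n_in.
by case/andP: n_in => n_gt0 n_le; apply: leq_trans n_le; exact: le_n.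
Qed.

Lemma succ_div_sub m d : 0 < d -> d <= m -> ((m - d) %/ d).+1 = m %/ d.
Proof. by move=> d_gt0 le_dm; rewrite -{2}(subnK le_dm) divnDr ?divnn ?d_gt0 ?addn1. Qed.

Lemma wp_sieve_pass x p a c :
  0 < p <= x -> prime p -> sieved x p a ->
  wp x (loop (x + 2) p p x (fun n => writeA n p))
    (fun _ a' c' => sieved x p.+1 a' /\ c <= c') a (c + 14 * bits x * (x %/ p)).
Proof.
move=> /andP[p_gt0 p_le] p_pr Sa.
have bits_le n : n <= x -> bits n <= bits x by exact: leq_bits.
have xp_gt0 : 0 < x %/ p by rewrite divn_gt0.
apply: (wp_loop_const _ _ (fun n _ a' => p %| n /\ forall k, 0 < k <= x ->
          a' k = if (p %| k) && (k < n) then p else a k)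
          (2 * bits x) c); [by apply/andP; split=> //; nia|lia|lia| | | |].
- split=> // k /andP[k_gt0 _]; case: andP => // -[/dvdn_leq le_pk]; lia.
- move=> n t a' n_le [p_n Ja']; have := bits_le n n_le; have := bits_le p p_le => ? ?.
  apply: (wp_writeA _ (2 * bits x)) => //; first by lia.
  split=> [|k k_in]; first exact: dvdn_add.
  rewrite /upd Nat_eqbE Ja' //; case: eqP => [->|ne].
    by rewrite p_n -[X in X < _]addn0 ltn_add2l p_gt0.
  case: (boolP (p %| k)) => //= p_k; congr (if _ then _ else _).
  (* The only multiple of [p] in the interval from [n] to [n + p - 1] is [n] itself, treated
     above. *)
  apply/idP/idP => [lt_kn|lt_k]; first by lia.
  case: (ltngtP k n) => // lt_nk; exfalso.
  have : p %| k - n by exact: dvdn_sub.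
  by move/dvdn_leq; lia.
- move=> m t a' c' m_gt [_ Ja'] c_le; split=> //.
  apply: (sieved_write _ _ _ _ p_pr Sa) => n n_in; rewrite Ja' //.
  have lt_nm : n < m by lia.
  by rewrite lt_nm andbT.
- rewrite succ_div_sub //; nia.
Qed.

Lemma wp_step_i x a c :
  1 < x ->
  wp x (step_i x) (fun _ a' c' => prime_factor_table x a' /\ c <= c') a
    (c + bits x * (40 * x + 14 * \sum_(2 <= p < x.+1 | prime p) x %/ p)).
Proof.
move=> x_gt1; set L := bits x; set S := \sum_(_ <= _ < _ | _) _.
have L_gt1 : 1 < L by exact: bits_gt1.
have bits_le n : n <= x -> bits n <= L by exact: leq_bits.
apply: wp_bind.
apply: (wp_loop_const _ _ (fun n _ a => forall k, 0 < k < n -> k <= x -> a k = k)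
          (2 * L) (c + L * (26 * x + 14 * S))); [nia|lia|lia|by move=> k; lia| | |].
- move=> n t {}a n_le Jn; have := bits_le n n_le => ?.
  apply: (wp_writeA _ (2 * L)) => //; first by lia.
  by move=> k k_in k_le; rewrite /upd Nat_eqbE; case: eqP => [//|ne]; apply: Jn => //; lia.
- move=> m t {}a c' m_gt Jm c'_ge; apply: wp_bind.
  pose R p := \sum_(p <= q < x.+1 | prime q) x %/ q.
  (* The increase [2 * p - 1] of the square pays, at [15 * L] per unit, for computing [p * p] at
     price at most [L * p] and for the other operations of the round. [L * (x + 5)] is kept for the
     last test, and [R p] pays for the passes to come. *)
  pose I p a c' := [/\ 1 < p, p.-1 ^ 2 <= x, sieved x p a &
    c + L * (x + 5) + 15 * L * (x - p.-1 ^ 2) + 14 * L * R p <= c'].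
  apply: (wp_while _ _ I (fun p => x.+1 - p)).
  + move=> p {m m_gt Jm} {}a {c'_ge} {}c' [p_gt1 p_sqr Sa c'_ge].
    have p_le : p <= x by nia.
    have bits_p := bits_le p p_le.
    have bits_p_self := bits_leq_self p (ltnW p_gt1).
    have bits_pp : bits (p * p) <= 2 * L.
      apply: bits_leq; last by lia.
      have := ltn_2bits x; rewrite mulnC expnM expnS expn1 -/L; nia.
    apply: wp_bind; apply: (wp_mul _ (L * p)); first by nia.
    apply: (wp_le _ (3 * L)); first by nia.
    case: leqP => [pp_le|pp_gt]; last first.
      apply/wp_ret; split; first exact: (sieved_done _ _ _ pp_gt Sa).
      nia.
    have ap_le : a p <= x by apply: (sieved_leq _ _ _ _ Sa); lia.
    have bits_ap := bits_le _ ap_le.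
    have RE : R p = (if prime p then x %/ p else 0) + R p.+1.
      by rewrite /R big_ltn_cond ?ltnS //; case: ifP.
    set c1 := c + L * (x + 5) + 15 * L * (x - p ^ 2) + 14 * L * R p.+1 + 2 * L.
    have c1_le : c1 + 14 * L * (if prime p then x %/ p else 0) + L * p + 7 * L <= c'.
      have [d xE] : exists d, x = p * p + d by exists (x - p * p); lia.
      have [q pE] : exists q, p = q.+1 by exists p.-1; lia.
      move: c'_ge; rewrite RE /c1.
      have -> : x - p ^ 2 = d by rewrite xE -mulnn; lia.
      have -> : x - p.-1 ^ 2 = d + 2 * q + 1 by rewrite xE pE -mulnn; lia.
      by rewrite [in L * p]pE; move: (R _) (if _ then _ else _) => r r'; lia.
    apply: wp_bind; apply: (wp_readA _ (2 * L)); first by lia.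
    apply: wp_bind; apply: (wp_eq _ (2 * L)); first by lia.
    rewrite (sieved_prime x) //; last by lia.
    apply: wp_bind; apply: (wp_conseq _ _ (fun _ a' c'' => sieved x p.+1 a' /\ c1 <= c'')).
      case: ifP c1_le => [p_pr|/negbT p_npr] c1_le.
        by apply: (wp_waste _ _ _ _ _ _ _ (wp_sieve_pass x p a c1 _ p_pr Sa)); lia.
      by apply/wp_ret; split; [exact: sieved_skip | lia].
    move=> _ a' c'' [Sa' c1_le']; have L_le : 2 * L <= c'' := leq_trans (leq_addl _ _) c1_le'.
    apply: (wp_add _ (2 * L)); first by rewrite (_ : bits 1 = 1) // L_le andbT; lia.
    split; last by lia.
    by rewrite addn1; split=> //=; rewrite ?leq_subRL // 1?addnC //; lia.
  + split=> //; first by rewrite /=; lia.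
    * move=> n n_in; left; split=> [|q q_pr q_lt]; first by apply: Jm; lia.
      by have := prime_gt1 q_pr; lia.
    * by apply: leq_trans c'_ge; rewrite /= /R -/S; nia.
  + by lia.
- by rewrite subn1 divn1 prednK; nia.
Qed.

Lemma wp_step_ii x a c :
  1 < x ->
  wp x (step_ii x) (fun _ a' c' => a' = a /\ c <= c') a (c + 18 * bits x * x).
Proof.
move=> x_gt1; have L_gt1 := bits_gt1 x x_gt1.
apply: (wp_loop_const _ _ (fun _ _ a' => a' = a) (6 * bits x) c) => //; [nia|lia|lia| |].
- move=> n _ _ n_le ->; have bits_n := leq_bits n x n_le.
  apply: wp_bind; apply: (wp_mod _ (2 * bits x)); first by rewrite (_ : bits 2 = 2) //; lia.
  have bits_r : bits (n %% 2) = 1 by rewrite modn2; case: odd.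
  apply: wp_bind; apply: (wp_eq _ (2 * bits x)).
    by rewrite bits_r (_ : bits 1 = 1) //; lia.
  set v := if _ then _ else _; have v_le : v <= 2 by rewrite /v; case: ifP.
  have := leq_bits v 2 v_le; rewrite (_ : bits 2 = 2) // => bits_v.
  by apply: (wp_writeV _ (2 * bits x)) => //; lia.
- by rewrite divn1 subn1 prednK; nia.
Qed.

(** * Factoring by repeated division *)

Lemma trunc_logM_leq m n :
  0 < m -> 0 < n -> trunc_log 2 m + trunc_log 2 n <= trunc_log 2 (m * n).
Proof. by move=> m_gt0 n_gt0; apply: trunc_log_max; rewrite // expnD leq_mul ?trunc_logP. Qed.

Lemma trunc_log_div_leq m q : 0 < m -> q %| m ->
  trunc_log 2 (m %/ q) + trunc_log 2 q <= trunc_log 2 m.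
Proof.
move=> m_gt0 q_m; have q_gt0 := dvdn_gt0 m_gt0 q_m.
have m_ge := dvdn_leq m_gt0 q_m.
have mq_gt0 : 0 < m %/ q by rewrite divn_gt0.
by have := trunc_logM_leq (m %/ q) q mq_gt0 q_gt0; rewrite divnK.
Qed.

Lemma prime_trunc_log_gt0 q : prime q -> 0 < trunc_log 2 q.
Proof. by move=> /prime_gt1 q_gt1; rewrite trunc_log_gt0. Qed.

(** A round of remainder, test and division costs [6 * L * lq], because [bits q <= 2 * lq]; dividing
    by [q] lowers [trunc_log 2 m] by at least [lq]. The final failing test costs [4 * L * lq]. *)
Lemma wp_remove_factor x q m a c :
  1 < x -> prime q -> q <= x -> 0 < m <= x ->
  wp x (whileM (x + 2) (fun m => t <- modM m q ;; eqM t 0) (fun m => divM m q) m)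
    (fun m' a' c' => [/\ a' = a, m' %| m, ~~ (q %| m') &
                         c + 6 * bits x * trunc_log 2 m' <= c'])
    a (c + 6 * bits x * trunc_log 2 m + 4 * bits x * trunc_log 2 q).
Proof.
move=> x_gt1 q_pr q_le /andP[m_gt0 m_le]; set L := bits x; set lq := trunc_log 2 q.
have L_gt1 : 1 < L by exact: bits_gt1.
have lq_gt0 : 0 < lq by exact: prime_trunc_log_gt0.
have bits_q : bits q <= 2 * lq by rewrite bitsE -/lq; lia.
pose I m1 a' c' := [/\ a' = a, m1 %| m &
  c + 6 * L * trunc_log 2 m1 + 4 * L * lq <= c'].
apply: (wp_while _ _ I id) => //=; last by lia.
move=> m1 _ c1 [-> m1_m c1_ge].
have m1_gt0 : 0 < m1 := dvdn_gt0 m_gt0 m1_m.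
have m1_le : m1 <= x := leq_trans (dvdn_leq m_gt0 m1_m) m_le.
have bits_m1 : bits m1 <= L := leq_bits m1 x m1_le.
have bits_prod : bits m1 * bits q <= 2 * L * lq by rewrite [2 * L]mulnC -mulnA leq_mul.
have bits_t : bits (m1 %% q) + bits 0 <= 2 * L * lq.
  have : bits (m1 %% q) <= L by apply: leq_bits; exact: leq_trans (leq_mod _ _) m1_le.
  by rewrite (_ : bits 0 = 1) //; nia.
apply: wp_bind; apply: (wp_mod _ (2 * L * lq)); first by lia.
apply: (wp_eq _ (2 * L * lq)); first by lia.
case: (boolP (m1 %% q == 0)) => q_m1; last by split=> //; lia.
have log_div := trunc_log_div_leq m1 q m1_gt0 q_m1.
have cost_div : 6 * L * trunc_log 2 (m1 %/ q) + 6 * L * lq <= 6 * L * trunc_log 2 m1.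
  by rewrite -mulnDr leq_mul2l log_div orbT.
apply: (wp_div _ (2 * L * lq)); first by lia.
split; last by rewrite ltn_Pdiv ?prime_gt1.
split=> //; last by lia.
by apply: dvdn_trans m1_m; apply/dvdnP; exists q; rewrite mulnC divnK.
Qed.

(** Budget for the writes to [V] still due for the prime [p] when [m] is the part of [p - 1] left to
    factor. *)
Definition divisor_weight x p m :=
  \sum_(2 <= r < x.+1 | prime r && (r %| m)) x %/ (p * r).

Lemma divisor_weight_drop x p q m m' :
  prime q -> q <= x -> q %| m -> m' %| m -> ~~ (q %| m') ->
  divisor_weight x p m' + x %/ (p * q) <= divisor_weight x p m.
Proof.
move=> q_pr q_le q_m m'_m q_m'; rewrite /divisor_weight.
rewrite [leqRHS]big_mkcond (bigD1_seq q) ?iota_uniq //=; last first.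
  by rewrite mem_index_iota ltnS q_le prime_gt1.
rewrite q_pr q_m /= addnC leq_add2l big_mkcond [leqRHS]big_mkcond; apply: leq_sum => r _.
case: ifP => // /andP[-> r_m']; rewrite (dvdn_trans r_m' m'_m) /=.
by case: eqP => // rq; rewrite -rq r_m' in q_m'.
Qed.

(** Budget of one prime factor, with [t], [s], [l] the logarithms of [m], [m %/ q], [q], and
    [37 = 31 + 6]. The terms [6 * L * t] and [4 * L * l] go to removing [q], [2 * L * l] to the
    product [p * q], [14 * L * u] to the writes, and [25 * L] to operations of fixed price. *)
Lemma factor_credits c c' L t s l w u :
  s + l <= t -> 0 < l -> u <= w -> c + 3 * L + 37 * L * t + 14 * L * w <= c' ->
  c + 3 * L + 31 * L * s + 14 * L * (w - u) + 6 * L * t + 4 * L * l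
    + 14 * L * u + 2 * L * l + 25 * L <= c'.
Proof.
move=> le_t l_gt0 le_u; apply: leq_trans.
have -> : 14 * L * w = 14 * L * (w - u) + 14 * L * u by rewrite -mulnDr subnK.
have : 31 * L * s + 31 * L * l <= 31 * L * t by rewrite -mulnDr leq_mul2l le_t orbT.
have : 25 * L <= 25 * L * l by rewrite leq_pmulr.
by clear; lia.
Qed.

(* Every distinct prime q found in m spends the drop of [trunc_log 2 m], which is
   at least that of q, on arithmetic, and its term of [divisor_weight] on V. *)
Lemma wp_factorize x p a c :
  1 < x -> prime p -> p <= x -> prime_factor_table x a ->
  wp x (whileM (x + 2)
          (fun m => leM 2 m)
          (fun m => q <- readA m ;;
                    o <- modM q 2 ;; b <- eqM o 1 ;;
                    (if b then (s <- mulM p q ;;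
                                loop (x + 2) p s x (fun n => writeV n 0))
                     else ret tt) ;;;
                    whileM (x + 2) (fun m => t <- modM m q ;; eqM t 0)
                                   (fun m => divM m q) m)
          (p - 1))
    (fun _ a' c' => a' = a /\ c <= c') a
    (c + 3 * bits x + 37 * bits x * trunc_log 2 p.-1 + 14 * bits x * divisor_weight x p p.-1).
Proof.
move=> x_gt1 p_pr p_le tab; rewrite subn1; set L := bits x.
have L_gt1 : 1 < L by exact: bits_gt1.
have p_gt1 := prime_gt1 p_pr.
pose I m a' c' := [/\ a' = a, m %| p.-1 &
  c + 3 * L + 37 * L * trunc_log 2 m + 14 * L * divisor_weight x p m <= c'].
apply: (wp_while _ _ I id) => //=; last by lia.
move=> m _ c' [-> m_p c'_ge].
have m_gt0 : 0 < m by apply: dvdn_gt0 m_p; lia.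
have m_le : m <= x by apply: leq_trans (dvdn_leq _ m_p) _; lia.
have bits_m : bits m <= L := leq_bits m x m_le.
apply: (wp_le _ (3 * L)); first by rewrite (_ : bits 2 = 2) //; lia.
case: ltnP => [m_gt1|_]; last by split=> //; lia.
have [q qE] : exists q, a m = q by exists (a m).
have [q_pr q_m] : prime q /\ q %| m by rewrite -qE; apply: tab; rewrite m_gt1.
have q_lem := dvdn_leq m_gt0 q_m.
have q_le : q <= x by exact: leq_trans q_lem m_le.
have bits_q : bits q <= L := leq_bits _ x q_le.
have lq_gt0 := prime_trunc_log_gt0 q q_pr.
have bits_q2 : bits q <= 2 * trunc_log 2 q by rewrite bitsE; lia.
have bits_r : bits (q %% 2) = 1 by rewrite modn2; case: odd.
pose u := x %/ (p * q); pose w := divisor_weight x p m.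
have drop m' : m' %| m -> ~~ (q %| m') -> divisor_weight x p m' + u <= w.
  exact: divisor_weight_drop.
have u_le : u <= w.
  by apply: leq_trans (leq_addl _ _) (drop 1 (dvd1n _) _); rewrite dvdn1 neq_ltn prime_gt1 ?orbT.
pose c2 := c + 3 * L + 31 * L * trunc_log 2 (m %/ q) + 14 * L * (w - u).
have [c1 c1E] : exists c1, c1 = c2 + 6 * L * trunc_log 2 m + 4 * L * trunc_log 2 q by eexists.
have c1_le : c1 + 14 * L * u + 2 * L * trunc_log 2 q + 25 * L <= c'.
  move: (trunc_log_div_leq m q m_gt0 q_m) lq_gt0 u_le c'_ge; rewrite c1E /c2 -/w.
  exact: factor_credits.
have {}c1_le : c1 + 14 * L * u + 2 * L * trunc_log 2 q + 22 * L <= c' - 3 * L.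
  by clear -c1_le; lia.
apply: (wp_waste _ _ _ _ _ _ _ _ c1_le).
apply: wp_bind; apply: (wp_readA _ (2 * L)); first by rewrite qE; clear -bits_m bits_q; lia.
rewrite qE.
apply: wp_bind; apply: (wp_mod _ (2 * L)).
  by rewrite (_ : bits 2 = 2) //; clear -bits_q; lia.
apply: wp_bind; apply: (wp_eq _ (2 * L)).
  by rewrite bits_r (_ : bits 1 = 1) //; clear -L_gt1; lia.
apply: wp_bind; apply: (wp_conseq _ _ (fun _ a' c'' => a' = a /\ c1 <= c'')).
  case: ifP => _; last by apply/wp_ret; split=> //; clear; lia.
  apply: wp_bind; apply: (wp_mul _ (2 * L * trunc_log 2 q)).
    apply/andP; split; last by clear; lia.
    by rewrite [2 * L]mulnC -mulnA leq_mul // leq_bits.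
  apply: (wp_loop_const _ _ (fun _ _ a' => a' = a) (2 * L) c1) => //.
  - by rewrite muln_gt0 !prime_gt0 // leq_mul.
  - by clear; lia.
  - move=> n _ _ n_le ->; have bits_n : bits n <= L := leq_bits n x n_le.
    by apply: (wp_writeV _ (2 * L)) => //; rewrite (_ : bits 0 = 1) //; clear -bits_n L_gt1; lia.
  (* The progression starts at [p] and may have [u + 1] terms; the extra one is paid from the fixed
     part of the budget. *)
  - have : (x - p) %/ (p * q) <= u by apply: leq_div2r; exact: leq_subr.
    rewrite -/L /u; move: ((x - p) %/ _) (x %/ _) => v y v_le.
    have : v.+1 * (8 * L + 2 * L) <= y.+1 * (10 * L) by apply: leq_mul => //; clear; lia.
    by clear; lia.
move=> _ _ c3 [->]; rewrite c1E => c3_ge.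
apply: (wp_conseq _ _ _ _ _ _ _ (wp_waste _ _ _ _ _ _ _
          (wp_remove_factor x q m a c2 x_gt1 q_pr q_le _) c3_ge)); first by rewrite m_gt0.
move=> {c3_ge} m' a' c4 [-> m'_m q_m' c4_ge].
have m'_gt0 : 0 < m' := dvdn_gt0 m_gt0 m'_m.
have m'_dvd : m' %| m %/ q.
  by rewrite dvdn_divRL // Gauss_dvd ?m'_m // coprime_sym prime_coprime.
have lm'_le : trunc_log 2 m' <= trunc_log 2 (m %/ q).
  by apply: leq_trunc_log; apply: dvdn_leq m'_dvd; rewrite divn_gt0 ?prime_gt0.
split.
  split=> //; first exact: dvdn_trans m'_m m_p.
  have w_le : divisor_weight x p m' <= w - u by rewrite leq_subRL // addnC drop.
  have : 31 * L * trunc_log 2 m' <= 31 * L * trunc_log 2 (m %/ q).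
    by rewrite leq_mul2l lm'_le orbT.
  have : 14 * L * divisor_weight x p m' <= 14 * L * (w - u) by rewrite leq_mul2l w_le orbT.
  by move: c4_ge; rewrite -/L /c2; clear; lia.
rewrite ltn_neqAle dvdn_leq // andbT.
by apply: contraNneq q_m' => ->.
Qed.

(** Table entries are prime, so a positive answer makes [p] prime; the expensive branches are
    therefore charged to primes alone. *)
Lemma wp_isPrimeM x p a c (Q : bool -> (nat -> nat) -> nat -> Prop) :
  1 < p <= x -> prime_factor_table x a ->
  (forall b : bool, (b -> prime p) -> Q b a c) ->
  wp x (isPrimeM p) Q a (c + 4 * bits x).
Proof.
move=> p_in tab Qb; have [ap_pr ap_p] := tab p p_in.
have [p_gt1 p_le] := andP p_in.
have bits_p := leq_bits p x p_le.
have bits_ap : bits (a p) <= bits x.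
  by apply: leq_bits; apply: leq_trans p_le; apply: dvdn_leq ap_p; exact: ltnW.
apply: wp_bind; apply: (wp_readA _ (2 * bits x)); first by clear -bits_p bits_ap; lia.
apply: (wp_eq _ (2 * bits x)); first by clear -bits_p bits_ap; lia.
rewrite (_ : c + 4 * bits x - 2 * bits x - 2 * bits x = c); last by clear; lia.
by apply: Qb => /eqP <-.
Qed.

Lemma wp_step_iii x a c :
  1 < x -> prime_factor_table x a ->
  wp x (step_iii x) (fun _ a' c' => a' = a /\ c <= c') a
    (c + bits x * (16 * x + \sum_(2 <= p < x.+1 | prime p)
                       (42 * (trunc_log 2 p).+1 + 14 * divisor_weight x p p.-1))).
Proof.
move=> x_gt1 tab; set L := bits x; have L_gt1 : 1 < L by exact: bits_gt1.
(* The 42 collects 37 per unit of logarithm from the factorization, its constant 3, and 2 for the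
   subtraction. *)
pose k p := if prime p then L * (42 * (trunc_log 2 p).+1 + 14 * divisor_weight x p p.-1) else 0.
apply: (wp_loop_sum _ (fun n a' => 1 < n /\ a' = a) (fun p => 4 * L + k p) c).
- exact: ltnW.
- by clear -x_gt1; lia.
- by clear; lia.
- by [].
- move=> p _ p_le [p_gt1 ->].
  have bits_p : bits p <= L by exact: leq_bits.
  apply: wp_bind; rewrite [4 * L + _]addnC; apply: wp_isPrimeM => //; first by rewrite p_gt1.
  case=> [/(_ isT) p_pr|_]; last by apply/wp_ret; split=> //; exact: ltn_addr.
  rewrite /k p_pr; apply: wp_bind; apply: (wp_sub _ (2 * L)).
    by rewrite (_ : bits 1 = 1) //; clear -bits_p L_gt1; nia.
  apply: wp_bind; apply: (wp_conseq _ _ _ _ _ _ _ (wp_waste _ _ _ _ _ _ _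
    (wp_factorize x p a 0 x_gt1 p_pr p_le tab) _)).
    have : trunc_log 2 p.-1 <= trunc_log 2 p by apply: leq_trunc_log; exact: leq_pred.
    rewrite -/L; move: (trunc_log 2 _) (trunc_log 2 _) (divisor_weight _ _ _) => l' l w le_l.
    have : 37 * L * l <= 37 * L * l' by rewrite leq_mul2l le_l orbT.
    by clear; lia.
  by move=> _ _ c' [-> _]; apply/wp_ret; split=> //; exact: ltn_addr.
- by move=> m [] a' c' _ [_ ->] c_le.
have -> : \sum_(2 <= p < x.+1) (8 * bits x + (4 * L + k p)) = (x - 1) * (12 * L) +
    L * \sum_(2 <= p < x.+1 | prime p) (42 * (trunc_log 2 p).+1 + 14 * divisor_weight x p p.-1).
  have <- : \sum_(2 <= p < x.+1) 12 * L = (x - 1) * (12 * L) by rewrite sum_nat_const_nat subSS.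
  rewrite big_distrr /= [X in _ = _ + X]big_mkcond -big_split; apply: eq_bigr => p _.
  by rewrite /k -/L /=; case: (prime p); clear; lia.
rewrite -/L; move: (\sum_(_ <= _ < _ | _) _) => s; clear -x_gt1; nia.
Qed.

Lemma wp_step_iv x a c :
  1 < x -> prime_factor_table x a ->
  wp x (step_iv x) (fun _ a' c' => a' = a /\ c <= c') a
    (c + bits x * (16 * x + 23 * \sum_(2 <= p < x.+1 | prime p) x %/ p)).
Proof.
move=> x_gt1 tab; set L := bits x; have L_gt1 : 1 < L by exact: bits_gt1.
pose k p := if prime p then 23 * L * (x %/ p) else 0.
apply: (wp_loop_sum _ (fun n a' => 1 < n /\ a' = a) (fun p => 4 * L + k p) c).
- exact: ltnW.
- by clear -x_gt1; lia.
- by clear; lia.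
- by [].
- move=> p _ p_le [p_gt1 ->].
  have bits_p : bits p <= L by exact: leq_bits.
  have p_gt0 : 0 < p by exact: ltnW.
  have xp_gt0 : 0 < x %/ p by rewrite divn_gt0.
  apply: wp_bind; rewrite [4 * L + _]addnC; apply: wp_isPrimeM => //; first by rewrite p_gt1.
  case=> [/(_ isT) p_pr|_]; last by apply/wp_ret; split=> //; exact: ltn_addr.
  (* The [9 * L] covers the remainder, its comparison and the final loop test; as [x %/ p >= 1], it
     is absorbed into the 23. *)
  rewrite /k p_pr; apply: (wp_waste _ _ (14 * L * (x %/ p) + 9 * L)); last first.
    by move: (x %/ p) xp_gt0 => u; clear; nia.
  have [y yE] : exists y, 14 * L * (x %/ p) = y by eexists.
  rewrite yE.
  have bits_t : bits (p %% 4) <= 2 by apply: (leq_bits _ 3); rewrite -ltnS ltn_mod.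
  apply: wp_bind; apply: (wp_mod _ (3 * L)).
    by rewrite (_ : bits 4 = 3) //; clear -bits_p; lia.
  apply: wp_bind; apply: (wp_eq _ (2 * L)).
    by rewrite (_ : bits 3 = 2) //; clear -bits_t L_gt1; lia.
  case: ifP => _; last by apply/wp_ret; split=> //; exact: ltn_addr.
  apply: (wp_loop_const _ _ (fun _ _ a' => a' = a) (6 * L) 0) => //.
  + by rewrite p_gt0; nia.
  + by clear; lia.
  + move=> n _ _ n_le ->; have bits_n : bits n <= L := leq_bits n x n_le.
    apply: wp_bind; apply: (wp_readV _ (2 * L)); first by clear -bits_n L_gt1; lia.
    move=> v v_le; have bits_v : bits v <= 2 by exact: (leq_bits v 2).
    apply: wp_bind; apply: (wp_eq _ (2 * L)).
      by rewrite (_ : bits 2 = 2) //; clear -bits_v L_gt1; lia.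
    case: ifP => _; last exact/wp_ret.
    apply: (wp_writeV _ (2 * L)) => //.
    by rewrite (_ : bits 1 = 1) //; clear -bits_n L_gt1; lia.
  + by move=> m [] a' c' _ -> _; split=> //; exact: ltn_addr.
  + by rewrite succ_div_sub // -/L -yE; clear; lia.
- by move=> m [] a' c' _ [_ ->] c_le.
have -> : \sum_(2 <= p < x.+1) (8 * bits x + (4 * L + k p)) = (x - 1) * (12 * L) +
    23 * L * \sum_(2 <= p < x.+1 | prime p) x %/ p.
  have <- : \sum_(2 <= p < x.+1) 12 * L = (x - 1) * (12 * L) by rewrite sum_nat_const_nat subSS.
  rewrite big_distrr /= [X in _ = _ + X]big_mkcond -big_split; apply: eq_bigr => p _.
  by rewrite /k -/L /=; case: (prime p); clear; lia.
rewrite -/L; move: (\sum_(_ <= _ < _ | _) _) => s; clear -x_gt1; nia.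
Qed.

Lemma wp_step_v x a c :
  1 < x -> wp x (step_v x) (fun _ _ c' => c <= c') a (c + 18 * bits x * x).
Proof.
move=> x_gt1; set L := bits x; have L_gt1 : 1 < L by exact: bits_gt1.
(* The count stays below the index, so its binary length is at most [L]. *)
apply: (wp_loop_const _ _ (fun n t _ => t < n) (6 * L) c) => //.
- by clear -x_gt1; nia.
- exact: ltnW.
- by clear; lia.
- move=> n t a' n_le t_lt; have bits_n : bits n <= L := leq_bits n x n_le.
  have bits_t : bits t <= L by apply: leq_bits; exact: leq_trans (ltnW t_lt) n_le.
  apply: wp_bind; apply: (wp_readV _ (2 * L)); first by clear -bits_n L_gt1; lia.
  move=> v v_le; have bits_v : bits v <= 2 by exact: (leq_bits v 2).
  apply: wp_bind; apply: (wp_eq _ (2 * L)).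
    by rewrite (_ : bits 1 = 1) //; clear -bits_v L_gt1; lia.
  case: ifP => _; last by apply/wp_ret; exact: ltn_addr.
  apply: (wp_add _ (2 * L)); last by rewrite ltn_add2r.
  by rewrite (_ : bits 1 = 1) //; clear -bits_t L_gt1; lia.
- by rewrite divn1 subn1 prednK ?(ltnW x_gt1) // -/L; clear -x_gt1; nia.
Qed.

(** * The total operation count *)

Definition algorithm_weight x :=
  x + \sum_(2 <= p < x.+1 | prime p)
        (x %/ p + (trunc_log 2 p).+1 + divisor_weight x p p.-1).

Lemma wp_algorithm x a :
  1 < x -> wp x (algorithm x) (fun _ _ _ => True) a (108 * bits x * algorithm_weight x).
Proof.
move=> x_gt1.
set A := \sum_(2 <= p < x.+1 | prime p) x %/ p.
set B := \sum_(2 <= p < x.+1 | prime p)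
            (42 * (trunc_log 2 p).+1 + 14 * divisor_weight x p p.-1).
(* Each [c] is the reserve handed on to the remaining steps, built from the last step backwards. The
   multiples of [x] add up to [40 + 18 + 16 + 16 + 18 = 108]. *)
pose c5 := 18 * bits x * x.
pose c4 := c5 + bits x * (16 * x + 23 * A).
pose c3 := c4 + bits x * (16 * x + B).
pose c2 := c3 + 18 * bits x * x.
apply: (wp_waste _ _ (c2 + bits x * (40 * x + 14 * A))); last first.
  suff AB : 37 * A + B <= 42 * \sum_(2 <= p < x.+1 | prime p)
              (x %/ p + (trunc_log 2 p).+1 + divisor_weight x p p.-1).
    have : bits x * (37 * A + B) <= bits x * (42 * (algorithm_weight x - x)).
      by rewrite leq_mul2l /algorithm_weight addKn AB orbT.
    have [W ->] : exists W, algorithm_weight x = x + W by eexists.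
    by rewrite addKn /c2 /c3 /c4 /c5; clear; lia.
  rewrite /A /B !big_distrr -big_split /=; apply: leq_sum => p _.
  by move: (x %/ p) (trunc_log _ _) (divisor_weight _ _ _); clear; lia.
apply: wp_bind; apply: (wp_conseq _ _ _ _ _ _ _ (wp_step_i x a c2 x_gt1)).
move=> _ a1 c1 [tab /(wp_waste _ _ _ _ _ _ _)]; apply.
apply: wp_bind; apply: (wp_conseq _ _ _ _ _ _ _ (wp_step_ii x a1 c3 x_gt1)).
move=> _ _ c1' [-> /(wp_waste _ _ _ _ _ _ _)]; apply.
apply: wp_bind; apply: (wp_conseq _ _ _ _ _ _ _ (wp_step_iii x a1 c4 x_gt1 tab)).
move=> _ _ c1'' [-> /(wp_waste _ _ _ _ _ _ _)]; apply.
apply: wp_bind; apply: (wp_conseq _ _ _ _ _ _ _ (wp_step_iv x a1 c5 x_gt1 tab)).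
move=> _ _ c1''' [-> /(wp_waste _ _ _ _ _ _ _)]; apply.
exact: (wp_conseq _ _ _ _ _ _ _ (wp_step_v x a1 0 x_gt1)).
Qed.

(** The constant is [1 + 5 + 26 + 16]; terms linear in [x] are absorbed because the last factor is
    at least 1. *)
Lemma algorithm_weight_leq x :
  1 < x -> algorithm_weight x <= 48 * x * (trunc_log 2 (trunc_log 2 x)).+1.
Proof.
move=> x_gt1; rewrite /algorithm_weight !big_split /=.
have := sum_prime_div_leq x x_gt1; have := sum_prime_log_leq x x_gt1.
have := sum_prime_pred_divisors_leq x.
move: (\sum_(_ <= _ < _ | _) _) (\sum_(_ <= _ < _ | _) _) (\sum_(_ <= _ < _ | _) _) => *.
lia.
Qed.

Lemma final_state_bounds :
  exists K : nat, forall x : nat, (2 <= x)%coq_nat ->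
    aborted (final_state x) = false /\
    (maxidx (final_state x) <= x)%coq_nat /\
    (maxval (final_state x) <= x)%coq_nat /\
    (cost (final_state x) <= K * bits x * x * bits (Nat.log2 x))%coq_nat.
Proof.
exists (108 * 48) => x /leP x_gt1.
have fine0 : fine x init_state by [].
have [[fa fi fv _] [c' le_c _]] := wp_algorithm x (fun=> 0) x_gt1 init_state fine0 erefl.
split=> //; split; first exact/leP.
split; first exact/leP.
have log2E : Nat.log2 x = trunc_log 2 x.
  by apply: succn_inj; rewrite -bitsE /bits Nat.add_1_r.
have w_le := algorithm_weight_leq x x_gt1.
rewrite log2E [bits (trunc_log _ _)]bitsE; apply/leP.
apply: leq_trans (leq_trans (leq_addr c' _) le_c) _; rewrite add0n.
have : 108 * bits x * algorithm_weight x
       <= 108 * bits x * (48 * x * (trunc_log 2 (trunc_log 2 x)).+1).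
  by rewrite leq_mul2l w_le orbT.
by move/leq_trans; apply; apply: eq_leq; lia.
Qed.

End OperationCount.

(** * Real logarithms *)

Lemma ln_nondecreasing (y z : R) : 0 < y -> y <= z -> ln y <= ln z.
Proof.
intros y_pos [y_lt | ->]; [left; apply ln_increasing; assumption | apply Rle_refl].
Qed.

(** The factor 2 comes from [ln 2 > 1/2]. *)
Lemma log2_le_ln (n : nat) : (0 < n)%nat -> INR (Nat.log2 n) <= 2 * ln (INR n).
Proof.
intros n_pos.
assert (pow_le : 2 ^ Nat.log2 n <= INR n).
{ rewrite <- (pow_INR 2). apply le_INR, Nat.log2_spec, n_pos. }
assert (pow_pos : 0 < 2 ^ Nat.log2 n) by (apply pow_lt; lra).
pose proof (ln_nondecreasing _ _ pow_pos pow_le) as H.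
rewrite ln_pow in H by lra.
pose proof ln_lt_2. pose proof (pos_INR (Nat.log2 n)). nra.
Qed.

(* Space: only O(x) array cells (indices <= x in two arrays) holding integers
   <= x; time: O(x log x log log x) bit operations. *)
Theorem theorem6p2 :
  exists (C : R) (x0 : nat), forall x : nat, (x0 <= x)%nat ->
    aborted (final_state x) = false /\
    (maxidx (final_state x) <= x)%nat /\
    (maxval (final_state x) <= x)%nat /\
    INR (cost (final_state x)) <= C * INR x * ln (INR x) * ln (ln (INR x)).
Proof.
destruct OperationCount.final_state_bounds as [K bounds].
(* Since [exp 1 <= 3], [x >= 27] gives [ln x >= 3] and [ln (ln x) >= 1]. Then [bits x <= 3 * ln x]
   and [bits (log2 x) <= 5 * ln (ln x)], whence 15. *)
exists (15 * INR K), 27%nat. intros x x_ge.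
destruct (bounds x) as [ok [idx [val cost_le]]]; [lia|].
repeat (split; [assumption|]).
assert (X_ge : 27 <= INR x) by (apply le_INR in x_ge; simpl INR in x_ge at 1; lra).
pose proof exp_le_3 as e_le. pose proof (exp_pos 1) as e_pos.
assert (l_ge : 3 <= ln (INR x)).
{ rewrite <- (ln_exp 3). apply ln_nondecreasing; [apply exp_pos|].
  replace 3 with (1 + 1 + 1) by ring. rewrite !exp_plus. nra. }
assert (ll_ge : 1 <= ln (ln (INR x))).
{ rewrite <- (ln_exp 1) at 1. apply ln_nondecreasing; lra. }
assert (log_pos : (0 < Nat.log2 x)%nat) by (apply Nat.log2_pos; lia).
assert (log_le := log2_le_ln x ltac:(lia)).
assert (loglog_le := log2_le_ln (Nat.log2 x) log_pos).
apply lt_INR in log_pos; simpl INR in log_pos at 1.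
assert (ln2_le : ln 2 <= 1).
{ rewrite <- (ln_exp 1) at 1. apply ln_nondecreasing; [lra|]. pose proof (exp_ineq1 1). lra. }
assert (ln_log_le : ln (INR (Nat.log2 x)) <= 1 + ln (ln (INR x))).
{ apply Rle_trans with (ln (2 * ln (INR x))); [apply ln_nondecreasing; assumption|].
  rewrite ln_mult by lra. lra. }
change (cost (final_state x) <= K * bits x * x * bits (Nat.log2 x))%nat in cost_le.
unfold bits in cost_le. apply le_INR in cost_le.
rewrite !mult_INR, !plus_INR in cost_le. simpl (INR 1) in cost_le.
apply Rle_trans with (1 := cost_le).
pose proof (pos_INR K).
apply Rle_trans with (INR K * (3 * ln (INR x)) * INR x * (5 * ln (ln (INR x)))).
- apply Rmult_le_compat; [| |apply Rmult_le_compat_r; [|apply Rmult_le_compat_l]|];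
    try (repeat apply Rmult_le_pos; lra); try lra.
  pose proof (pos_INR (Nat.log2 (Nat.log2 x))). lra.
- apply Req_le. ring.
Qed.
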